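(* Let $s,t$ be real numbers with $|1-2t|<|1-2s|$ and such that $1-2t$ and $1-2s$ have the same sign (both positive or both negative). Let $A, B$ be $n\times n$ positive semidefinite complex matrices, assumed in addition to be positive definite if $s\notin[0,1]$ (so that all powers below are defined), and let $X$ be any $n\times n$ complex matrix. Then for every unitarily invariant norm $|||\cdot|||$ on $n\times n$ complex matrices, $$|||A^{1-t}XB^t-A^tXB^{1-t}|||\le \left|\frac{1-2t}{1-2s}\right|\,|||A^{1-s}XB^s-A^sXB^{1-s}|||.$$
   Context: A norm $|||\cdot|||$ on $n\times n$ complex matrices is unitarily invariant if $|||UXV|||=|||X|||$ for all matrices $X$ and all unitary $U,V$. Nonnegative real powers of positive semidefinite matrices (and arbitrary real powers of positive definite matrices) are defined by the spectral functional calculus, with the convention $A^0=I$. Under the hypotheses $t$ lies strictly between $s$ and $1/2$, so if $s\in[0,1]$ then also $t\in[0,1]$. *)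

(* Defs.v *)
From mathcomp Require Import all_boot all_order all_algebra.
From mathcomp Require Import sesquilinear spectral.
From mathcomp Require Import complex.
From mathcomp Require Import reals exp.

Set Implicit Arguments.
Unset Strict Implicit.
Unset Printing Implicit Defensive.

Import Order.TTheory GRing.Theory Num.Theory.
Local Open Scope ring_scope.
Local Open Scope complex_scope.
Local Open Scope sesquilinear_scope.

(* In R[i], 0 <= z means that z is real and nonnegative. *)
Definition psdmx (R : realType) (n : nat) (A : 'M[R[i]]_n) : Prop :=
  A \is hermsymmx /\
  forall u : 'cV[R[i]]_n, 0 <= (u ^t* *m A *m u) 0 0.

Definition posdefmx (R : realType) (n : nat) (A : 'M[R[i]]_n) : Prop :=
  A \is hermsymmx /\
  forall u : 'cV[R[i]]_n, u != 0 -> 0 < (u ^t* *m A *m u) 0 0.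

(* spectralmx A and spectral_diag A are a chosen unitary P and eigenvalue vector
   d such that A = P^-1 * diag d * P (for normal A).  For Hermitian A the
   eigenvalues are real, so that complex.Re loses nothing. *)
Definition spectral_fun (R : realType) (n : nat) (f : R -> R)
    (A : 'M[R[i]]_n) : 'M[R[i]]_n :=
  invmx (spectralmx A)
    *m diag_mx (map_mx (fun z => (f (complex.Re z))%:C) (spectral_diag A))
    *m spectralmx A.

(* The value does not depend on the diagonalization chosen by spectralmx. *)
Lemma spectral_funE (R : realType) (n : nat) (f : R -> R)
    (U : 'M[R[i]]_n) (d : 'rV[R[i]]_n) : U \is unitarymx ->
  spectral_fun f (invmx U *m diag_mx d *m U) =
  invmx U *m diag_mx (map_mx (fun z => (f (complex.Re z))%:C) d) *m U.
Proof.
move=> Uu; set A := invmx U *m _ *m U; rewrite /spectral_fun.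
have Uunit := unitarymx_unit Uu.
have /orthomx_spectralP : A \is normalmx.
  by apply/orthomx_spectral_subproof; exists (U, d).
set P := spectralmx A; set e := spectral_diag A => AE.
have Punit : P \in unitmx := spectral_unit A.
pose g (z : R[i]) := (f (complex.Re z))%:C.
pose W := P *m invmx U.
have WE : W *m diag_mx d = diag_mx e *m W.
  have : P *m A *m invmx U = P *m A *m invmx U by [].
  rewrite {1}/A {1}AE /W !mulmxA mulmxK // mulmxV //.
  by rewrite mul1mx.
have WgE : W *m diag_mx (map_mx g d) = diag_mx (map_mx g e) *m W.
  apply/matrixP => i j; have := congr1 (fun M : 'M_n => M i j) WE.
  rewrite !mul_mx_diag !mul_diag_mx; move: {WE} W => w; rewrite !mxE.
  rewrite ![_ * w i j]mulrC.
  have [->|w0 /(mulfI w0) ->//] := eqVneq (w i j) 0.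
  by rewrite !mul0r.
rewrite -/g; transitivity (invmx P *m (diag_mx (map_mx g e) *m W) *m U).
  by rewrite /W !mulmxA mulmxKV.
by rewrite -WgE /W !mulmxA mulVmx // mul1mx.
Qed.

(* As 0 `^ 0 = 1, mxpow A 0 = 1%:M even for singular A. *)
Definition mxpow (R : realType) (n : nat) (A : 'M[R[i]]_n) (r : R) :
    'M[R[i]]_n :=
  spectral_fun (fun x => x `^ r) A.

Record unitarily_invariant_norm (R : realType) (n : nat)
    (N : 'M[R[i]]_n -> R) : Prop := UnitarilyInvariantNorm {
  uinorm_eq0 : forall X, N X = 0 -> X = 0;
  uinormZ : forall (c : R[i]) X, N (c *: X) = complex.Re `|c| * N X;
  uinormD : forall X Y, N (X + Y) <= N X + N Y;
  uinormU : forall U V X, U \is unitarymx -> V \is unitarymx ->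
    N (U *m X *m V) = N X }.

(* Main.v *)
Require Import Defs.
From mathcomp Require Import all_boot all_order all_algebra.
From mathcomp Require Import sesquilinear spectral.
From mathcomp Require Import complex.
From mathcomp Require Import reals sequences exp.
From mathcomp Require Import ring lra.
Set Implicit Arguments.
Unset Strict Implicit.
Unset Printing Implicit Defensive.
Import Order.TTheory GRing.Theory Num.Theory.
Local Open Scope ring_scope.
Local Open Scope complex_scope.

(* In eigenbases of A and B, with eigenvalues exp(2 x_i) and exp(2 y_j), the two
   matrices are entrywise products of one matrix with sinh((1-2t) w) and
   sinh((1-2s) w), w = x_i - y_j.  Up to a limit, 2 sinh z is
   (1 + z/m)^m - (1 - z/m)^m, a polynomial c z prod_k (z - r_k) with purely
   imaginary r_k.  So for 0 < p < q the quotient of the values at p w and q w is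
   p/q times the product of the factors (p w - r_k) / (q w - r_k), and each of
   these is a convex combination of 1 and a resolvent 1 / (1 + i kappa w), which
   acts as a contraction for every unitarily invariant norm.  Rows and columns of
   zero eigenvalues are removed by a pinching. *)

(** * Scalar estimates: limits along 1 / (k + 1) and the rate of (1 + z/m)^m *)

(** Serves as the passage to the limit in k, by the Archimedean property alone. *)
Lemma ler_add_inv_nat (R : realType) (x y K : R) :
  (forall k : nat, x <= y + K / k.+1%:R) -> x <= y.
Proof.
move=> h; rewrite leNgt; apply/negP => lt_yx.
have d0 : 0 < x - y by rewrite subr_gt0.
have K0 : 0 <= K by have := h 0%N; rewrite divr1; lra.
set k := Num.Def.archi_bound (K / (x - y)).
have : K / (x - y) < k.+1%:R.
  apply: lt_le_trans (archi_boundP _) _; first by rewrite divr_ge0 // ltW.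
  by rewrite ler_nat.
rewrite ltr_pdivrMr // mulrC -ltr_pdivrMr ?ltr0Sn // => lt_K.
by have := h k; rewrite leNgt -ltrBrDl lt_K.
Qed.

(** After (1 - t) z is cancelled and t divided out, an error of order t^2 becomes one of order t. *)
Lemma le_cancel_affine (R : realFieldType) (t z m w a b : R) : 0 < t ->
  z <= b -> b <= a + t ^+ 2 * w -> a <= (1 - t) * z + t * m -> z <= m + w * t.
Proof. by move=> t0 zb; rewrite expr2 => ba am; rewrite -(ler_pM2l t0); lra. Qed.

Lemma bernoulli_sub (R : realType) (h : R) (k : nat) :
  0 <= h <= 1 -> 1 - k%:R * h <= (1 - h) ^+ k.
Proof.
case/andP=> h0 h1; elim: k => [|k IH]; first by rewrite mul0r subr0.
rewrite exprS; apply: le_trans (ler_wpM2l _ IH); last by lra.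
rewrite -natr1; have : 0 <= k%:R * h ^+ 2 by rewrite mulr_ge0 ?sqr_ge0.
by rewrite expr2; nra.
Qed.

(** Let m = k + 1. If |z| <= m, then (1 + z/m)^m <= exp z, and (1 + z/m)^m exp(-z) >= (1 -
    z^2/m^2)^m >= 1 - z^2/m by Bernoulli. If |z| > m, both terms are at most exp |z| in absolute
    value, and z^2/m >= 1 makes this crude bound sufficient. *)
Lemma expR_approx (R : realType) (z : R) (k : nat) :
  `|(1 + z / k.+1%:R) ^+ k.+1 - expR z| <= 2 * expR `|z| * z ^+ 2 / k.+1%:R.
Proof.
have [m mE] : {m : R | m = k.+1%:R} by exists k.+1%:R.
have m0 : 0 < m by rewrite mE ltr0Sn.
rewrite -mE.
have le_exp (x : R) : 0 <= 1 + x / m -> (1 + x / m) ^+ k.+1 <= expR x.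
  move=> x0; have -> : expR x = expR (x / m) ^+ k.+1.
    by rewrite -expRM_natl -mE mulrC divfK // gt_eqF.
  by rewrite lerXn2r ?nnegrE ?expR_ge0 ?expR_ge1Dx.
have ez : expR z <= expR `|z| by rewrite ler_expR ler_norm.
have ez0 : 0 < expR `|z| := expR_gt0 _.
have [le_zm|lt_mz] := lerP `|z| m.
  have /andP[zm1 zm2] : -1 <= z / m <= 1.
    by rewrite -ler_norml normrM normfV (gtr0_norm m0) ler_pdivrMr ?mul1r.
  have up : (1 + z / m) ^+ k.+1 <= expR z by apply: le_exp; lra.
  have lo : (1 - z ^+ 2 / m) * expR z <= (1 + z / m) ^+ k.+1.
    have -> : (1 + z / m) ^+ k.+1 =
        (1 + z / m) ^+ k.+1 * expR (- z) * expR z.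
      by rewrite -mulrA -expRD addNr expR0 mulr1.
    rewrite ler_pM2r ?expR_gt0 //.
    apply: le_trans (_ : (1 + z / m) ^+ k.+1 * (1 + - z / m) ^+ k.+1 <= _).
      rewrite -exprMn (_ : (1 + z / m) * _ = 1 - (z / m) ^+ 2); last by ring.
      apply: le_trans (bernoulli_sub _ _); last first.
        by rewrite sqr_ge0 expr2; nra.
      rewrite lerD2l lerN2 -mE le_eqVlt; apply/orP; left; apply/eqP.
      by field; rewrite gt_eqF.
    rewrite ler_wpM2l ?exprn_ge0 //; first by lra.
    by apply: le_exp; lra.
  rewrite distrC ger0_norm ?subr_ge0 //.
  apply: le_trans (_ : z ^+ 2 / m * expR z <= _); first by lra.
  rewrite mulrC -mulrA ler_wpM2r ?divr_ge0 ?sqr_ge0 ?ltW //; lra.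
have zm0 : 0 <= `|z| / m by rewrite divr_ge0 // ltW.
have h1 : `|(1 + z / m) ^+ k.+1| <= expR `|z|.
  rewrite normrX; apply: le_trans (_ : (1 + `|z| / m) ^+ k.+1 <= _).
    rewrite lerXn2r ?nnegrE ?addr_ge0 //.
    by apply: le_trans (ler_normD _ _) _; rewrite normr1 normrM normfV (gtr0_norm m0).
  by apply: le_exp; rewrite addr_ge0.
have h2 : 1 <= z ^+ 2 / m.
  have m1 : 1 <= m by rewrite mE ler1n.
  by rewrite ler_pdivlMr // mul1r -real_normK ?num_real // expr2; nra.
apply: le_trans (ler_normB _ _) _; rewrite (gtr0_norm (expR_gt0 _)).
by apply: le_trans (_ : 2 * expR `|z| <= _); [lra|rewrite -mulrA ler_peMr //; lra].
Qed.

(** * Schur multipliers *)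

Definition schur {R : realType} {n : nat} (F : 'I_n -> 'I_n -> R[i])
    (Y : 'M[R[i]]_n) : 'M[R[i]]_n :=
  \matrix_(i, j) (F i j * Y i j).

Lemma eq_schur (R : realType) (n : nat) (F G : 'I_n -> 'I_n -> R[i])
    (Y : 'M[R[i]]_n) :
  (forall i j, F i j = G i j) -> schur F Y = schur G Y.
Proof. by move=> h; apply/matrixP => i j; rewrite !mxE h. Qed.

Lemma schurM (R : realType) (n : nat) (F G : 'I_n -> 'I_n -> R[i])
    (Y : 'M[R[i]]_n) :
  schur (fun i j => F i j * G i j) Y = schur F (schur G Y).
Proof. by apply/matrixP => i j; rewrite !mxE mulrA. Qed.

Lemma schurZ (R : realType) (n : nat) (c : R[i]) (F : 'I_n -> 'I_n -> R[i])
    (Y : 'M[R[i]]_n) :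
  schur (fun i j => c * F i j) Y = c *: schur F Y.
Proof. by apply/matrixP => i j; rewrite !mxE mulrA. Qed.

(** The link with unitary invariance: for unimodular u and v both diagonal factors are unitary. *)
Lemma schur_diag (R : realType) (n : nat) (u v : 'I_n -> R[i])
    (Y : 'M[R[i]]_n) :
  schur (fun i j => u i * v j) Y =
  diag_mx (\row_i u i) *m Y *m diag_mx (\row_j v j).
Proof. by rewrite mul_diag_mx mul_mx_diag; apply/matrixP => i j; rewrite !mxE mulrAC. Qed.

Lemma diag_unitary (R : realType) (n : nat) (u : 'I_n -> R[i]) :
  (forall i, `|u i| = 1) -> diag_mx (\row_i u i) \is unitarymx.
Proof.
move=> hu; apply/unitarymxP; rewrite tr_diag_mx map_diag_mx mulmx_diag.
rewrite -diag_const_mx; congr diag_mx; apply/rowP => i.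
by rewrite !mxE -normCK hu expr1n.
Qed.

(** * Contractive multipliers for a unitarily invariant norm *)

Section UINorm.
Variables (R : realType) (n : nat) (N : 'M[R[i]]_n -> R).
Hypothesis hN : unitarily_invariant_norm N.
Implicit Types (Y Z : 'M[R[i]]_n) (x y : 'I_n -> R).

Lemma uinormZr (c : R) Y : 0 <= c -> N (c%:C *: Y) = c * N Y.
Proof. by move=> c0; rewrite (uinormZ hN) ger0_norm ?ler0c. Qed.

Lemma uinormN Y : N (- Y) = N Y.
Proof. by rewrite -scaleN1r (uinormZ hN) normrN1 mul1r. Qed.

Lemma uinorm0 : N 0 = 0.
Proof. by rewrite -(scale0r (0 : 'M[R[i]]_n)) (uinormZ hN) normr0 mul0r. Qed.

Lemma uinorm_ge0 Y : 0 <= N Y.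
Proof.
by have := uinormD hN Y (- Y); rewrite uinormN subrr uinorm0; lra.
Qed.

Lemma uinorm_sum (I : Type) (r : seq I) (P : pred I) (F : I -> 'M[R[i]]_n) :
  N (\sum_(i <- r | P i) F i) <= \sum_(i <- r | P i) N (F i).
Proof.
elim/big_ind2 : _ => [|X a Y b hX hY|//]; first by rewrite uinorm0.
by apply: le_trans (uinormD hN _ _) (lerD hX hY).
Qed.

Lemma uinorm_unimodular (u v : 'I_n -> R[i]) Y :
  (forall i, `|u i| = 1) -> (forall i, `|v i| = 1) ->
  N (schur (fun i j => u i * v j) Y) = N Y.
Proof. by move=> hu hv; rewrite schur_diag (uinormU hN) ?diag_unitary. Qed.

(** The multiplier is the average of the four isometries with symbols 1, u_i, v_j and u_i v_j. It is
    used with Cayley transforms for the resolvents and with signs for the pinching. *)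
Lemma uinorm_half_unimodular (u v : 'I_n -> R[i]) Y :
  (forall i, `|u i| = 1) -> (forall i, `|v i| = 1) ->
  N (schur (fun i j => (1 + u i) / 2 * ((1 + v j) / 2)) Y) <= N Y.
Proof.
move=> hu hv; have h1 (i : 'I_n) : `|1 : R[i]| = 1 by rewrite normr1.
have -> : schur (fun i j => (1 + u i) / 2 * ((1 + v j) / 2)) Y =
    (4^-1)%:C *: (Y + schur (fun i j => u i * 1) Y +
      schur (fun i j => 1 * v j) Y + schur (fun i j => u i * v j) Y).
  apply/matrixP => i j; by rewrite !mxE fmorphV rmorph_nat; field.
rewrite uinormZr ?invr_ge0 //.
have D := uinormD hN.
have := D (Y + schur (fun i j => u i * 1) Y + schur (fun i j => 1 * v j) Y)
  (schur (fun i j => u i * v j) Y).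
have := D (Y + schur (fun i j => u i * 1) Y) (schur (fun i j => 1 * v j) Y).
have := D Y (schur (fun i j => u i * 1) Y).
by rewrite !uinorm_unimodular //; lra.
Qed.

Lemma unit_1Di (a : R) : 1 + 'i * a%:C != 0.
Proof. by apply/eqP => /(congr1 (@complex.Re R)) /=; lra. Qed.

Lemma norm_cayley (a : R) : `|(1 - 'i * a%:C) / (1 + 'i * a%:C)| = 1.
Proof.
rewrite normf_div -[X in _ / X]normcJ.
have -> : (1 + 'i * a%:C)^* = 1 - 'i * a%:C.
  by apply/eqP; rewrite eq_complex /=; apply/andP; split; apply/eqP; ring.
rewrite divff // normr_eq0.
by have := unit_1Di (- a); rewrite rmorphN mulrN.
Qed.

(* 1 / (1 + i a) is the midpoint of 1 and the unimodular (1 - i a) / (1 + i a). *)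
Lemma uinorm_le_mul_1Di x y Z :
  N Z <= N (schur (fun i j => (1 + 'i * (x i)%:C) * (1 + 'i * (y j)%:C)) Z).
Proof.
set Y := schur _ Z.
have -> : Z = schur (fun i j =>
    (1 + (1 - 'i * (x i)%:C) / (1 + 'i * (x i)%:C)) / 2 *
    ((1 + (1 - 'i * (y j)%:C) / (1 + 'i * (y j)%:C)) / 2)) Y.
  apply/matrixP => i j; rewrite !mxE.
  by field; rewrite !unit_1Di.
by apply: uinorm_half_unimodular => i; exact: norm_cayley.
Qed.

(* The map Z |-> i (x_i - y_j) Z_ij generates isometries, hence is dissipative;
   the isometries are replaced to second order by the product in
   uinorm_le_mul_1Di. *)
Lemma uinorm_le_resolvent x y Z :
  N Z <= N (schur (fun i j => 1 + 'i * (x i - y j)%:C) Z).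
Proof.
set M := schur _ Z.
pose W := schur (fun i j => (x i * y j)%:C) Z.
apply: (@ler_add_inv_nat _ _ _ (N W)) => k.
have [t tE] : {t : R | t = k.+1%:R^-1} by exists k.+1%:R^-1.
rewrite -tE.
have t0 : 0 < t by rewrite tE invr_gt0 ltr0Sn.
have t1 : t <= 1 by rewrite tE invf_le1 ?ltr0Sn // ler1n.
(* The product (1 + i t x)(1 - i t y) equals (1 - t) + t (1 + i (x - y)) + t^2 x y; only the last
   term, carried by [W], is an error. *)
clear tE; have h := uinorm_le_mul_1Di (fun i => t * x i) (fun j => - (t * y j)) Z.
rewrite (_ : schur _ Z = (1 - t)%:C *: Z + t%:C *: M + (t ^+ 2)%:C *: W) in h;
  last first.
  apply/matrixP => i j; rewrite !mxE.
  have i2 : 'i * 'i = -1 :> R[i] by rewrite -expr2 sqr_i.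
  rewrite !(rmorphN, rmorphB, rmorphM, rmorphXn, rmorph1).
  by ring: i2.
have := uinormD hN ((1 - t)%:C *: Z + t%:C *: M) ((t ^+ 2)%:C *: W).
have := uinormD hN ((1 - t)%:C *: Z) (t%:C *: M).
rewrite !uinormZr ?sqr_ge0 ?subr_ge0 ?(ltW t0) // => h1 h2.
exact: le_cancel_affine t0 h h2 h1.
Qed.

(* (p w - r) / (q w - r) is a convex combination of 1 and - r / (q w - r). *)
Lemma uinorm_le_linear x y (p q rho : R) Z : 0 <= p <= q -> 0 < q ->
  N (schur (fun i j => (p * (x i - y j))%:C - 'i * rho%:C) Z) <=
  N (schur (fun i j => (q * (x i - y j))%:C - 'i * rho%:C) Z).
Proof.
case/andP=> p0 pq q0; set M := schur (fun i j => (q * _)%:C - _) Z.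
pose c : R[i] := - ('i * rho%:C).
(* Here c = - r with r = i rho. For nonzero rho, q w - r = c (1 + i (q / rho) w), so the resolvent
   bound applies; for rho = 0 the left side is the norm of 0. *)
have hM : N (c *: Z) <= N M.
  have [rho0|rho0] := eqVneq rho 0.
    by rewrite /c rho0 mulr0 oppr0 scale0r uinorm0 uinorm_ge0.
  have -> : M = schur (fun i j => 1 + 'i * (q / rho * x i - q / rho * y j)%:C)
                      (c *: Z).
    apply/matrixP => i j; rewrite !mxE mulrA; congr (_ * _).
    have i2 : 'i * 'i = -1 :> R[i] by rewrite -expr2 sqr_i.
    have rho1 : rho%:C * (rho^-1)%:C = 1 by rewrite -rmorphM divff.
    rewrite /c !(rmorphB, rmorphM).
    by ring: i2 rho1.
  exact: uinorm_le_resolvent.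
have -> : schur (fun i j => (p * (x i - y j))%:C - 'i * rho%:C) Z =
    (p / q)%:C *: M + (1 - p / q)%:C *: (c *: Z).
  apply/matrixP => i j; rewrite !mxE mulrA -mulrA.
  have q1 : q%:C * (q^-1)%:C = 1 by rewrite -rmorphM divff // gt_eqF.
  rewrite /c !(rmorphB, rmorphM, rmorph1).
  by ring: q1.
have le1 : p / q <= 1 by rewrite ler_pdivrMr ?mul1r.
have ge0 : 0 <= p / q by rewrite divr_ge0 // ltW.
apply: le_trans (uinormD hN _ _) _; rewrite !uinormZr ?subr_ge0 //.
by have := uinorm_ge0 M; nra.
Qed.

(** Factors pass from p to q one at a time. Multipliers commute, so a factor already at q is
    absorbed into [Z] before the induction hypothesis is applied. *)
Lemma uinorm_le_prod x y (p q : R) (rs : seq R[i]) Z : 0 <= p <= q -> 0 < q ->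
  (forall r, r \in rs -> complex.Re r = 0) ->
  N (schur (fun i j => \prod_(r <- rs) ((p * (x i - y j))%:C - r)) Z) <=
  N (schur (fun i j => \prod_(r <- rs) ((q * (x i - y j))%:C - r)) Z).
Proof.
move=> pq q0; elim: rs Z => [|r rs IH] Z hrs.
  by rewrite (eq_schur (G := fun i j =>
    \prod_(r <- [::]) ((q * (x i - y j))%:C - r))) // => i j; rewrite !big_nil.
have r0 : r = 'i * (complex.Im r)%:C.
  by rewrite {1}(complexE r) hrs ?mem_head // add0r.
pose f a i j := (a * (x i - y j))%:C - r.
pose g a i j := \prod_(r <- rs) ((a * (x i - y j))%:C - r).
rewrite (eq_schur (G := fun i j => f p i j * g p i j)); last first.
  by move=> i j; rewrite /= big_cons.
rewrite [in leRHS](eq_schur (G := fun i j => g q i j * f q i j)); last first.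
  by move=> i j; rewrite /= big_cons mulrC.
rewrite !schurM; apply: le_trans (_ : N (schur (f q) (schur (g p) Z)) <= _).
  by rewrite /f r0; apply: uinorm_le_linear.
rewrite -schurM (eq_schur (G := fun i j => g p i j * f q i j)); last first.
  by move=> i j; rewrite mulrC.
by rewrite schurM; apply: IH => r' hr'; apply: hrs; rewrite inE hr' orbT.
Qed.

(** A crude bound, enough to turn entrywise convergence of symbols into convergence of norms. *)
Lemma uinorm_schur_le (F : 'I_n -> 'I_n -> R) Y :
  N (schur (fun i j => (F i j)%:C) Y) <=
  \sum_i \sum_j `|F i j| * N (Y i j *: delta_mx i j).
Proof.
rewrite {1}[schur _ _]matrix_sum_delta.
apply: le_trans (uinorm_sum _ _ _) _; apply: ler_sum => i _.
apply: le_trans (uinorm_sum _ _ _) _; apply: ler_sum => j _.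
rewrite mxE -scalerA (uinormZ hN) normc_def /= expr0n addr0 sqrtr_sqr.
exact: lexx.
Qed.

End UINorm.

(** * Comparison of sinh multipliers through polynomial approximation *)

(* Roots r satisfy |1 + r| = |1 - r|. *)
Lemma expr_1D_sub_1B_factor (R : realType) (k : nat) :
  exists (c : R[i]) (rs : seq R[i]),
    (forall r, r \in rs -> complex.Re r = 0) /\
    forall z : R[i], (1 + z) ^+ k.+1 - (1 - z) ^+ k.+1 =
      c * z * \prod_(r <- rs) (z - r).
Proof.
(* The root 0 is split off by hand, since (1 + z) - (1 - z) = 2 z divides the difference; this
   factor later yields the constant p / q, and only the cofactor [P] is split into roots. *)
pose P : {poly R[i]} := \sum_(i < k.+1) (1 + 'X) ^+ (k - i) * (1 - 'X) ^+ i.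
have PE (z : R[i]) : (1 + z) ^+ k.+1 - (1 - z) ^+ k.+1 = 2 * z * P.[z].
  rewrite subrXX /P horner_sum; congr (_ * _); first by ring.
  by apply: eq_bigr => i _; rewrite !hornerE.
have [rs Prs] := closed_field_poly_normal P.
have Phorner (z : R[i]) : P.[z] = lead_coef P * \prod_(r <- rs) (z - r).
  rewrite {1}Prs hornerZ horner_prod; congr (_ * _).
  by apply: eq_bigr => r _; rewrite !hornerE.
exists (2 * lead_coef P), rs; split=> [r r_rs|z]; last first.
  by rewrite PE Phorner; ring.
have /eqP : (1 + r) ^+ k.+1 - (1 - r) ^+ k.+1 = 0.
  by rewrite PE Phorner (big_rem r) //= subrr mul0r !mulr0.
rewrite subr_eq0 => /eqP /(congr1 (fun z => `|z|)); rewrite !normrX => /eqP.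
rewrite eqrXn2 ?normr_ge0 // => /eqP /(congr1 (fun z => z ^+ 2)).
rewrite -!add_Re2_Im2 => /complexI; case: r {r_rs} => a b /=.
by rewrite !expr2; lra.
Qed.

Section Sinh.
Variables (R : realType) (n : nat) (N : 'M[R[i]]_n -> R).
Hypothesis hN : unitarily_invariant_norm N.
Variables (x y : 'I_n -> R) (Z : 'M[R[i]]_n).

(** This is 2 sinh z; [pow_diff] is its polynomial approximation with m = k + 1. *)
Let exp_diff (z : R) : R := expR z - expR (- z).
Let pow_diff (k : nat) (z : R) : R :=
  (1 + z / k.+1%:R) ^+ k.+1 - (1 - z / k.+1%:R) ^+ k.+1.
Let term (f : R -> R) (a : R) := schur (fun i j => (f (a * (x i - y j)))%:C) Z.

Lemma uinorm_pow_diff k (p q : R) : 0 <= p <= q -> 0 < q ->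
  q * N (term (pow_diff k) p) <= p * N (term (pow_diff k) q).
Proof.
move=> pq q0; have [c [rs [hrs cE]]] := expr_1D_sub_1B_factor R k.
(* [Z'] absorbs what p and q have in common, the constant c and the factor w / m, so that the root 0
   contributes just the scalar a. *)
pose x' i := x i / k.+1%:R; pose y' i := y i / k.+1%:R.
pose Z' := schur (fun i j => c * (x' i - y' j)%:C) Z.
have termE a : term (pow_diff k) a = a%:C *:
    schur (fun i j => \prod_(r <- rs) ((a * (x' i - y' j))%:C - r)) Z'.
  rewrite -schurZ -schurM; apply: eq_schur => i j.
  have -> : pow_diff k (a * (x i - y j)) =
      (1 + a * (x' i - y' j)) ^+ k.+1 - (1 - a * (x' i - y' j)) ^+ k.+1.
    by rewrite /pow_diff /x' /y' -mulrBl mulrA.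
  rewrite rmorphB !rmorphXn rmorphB rmorphD rmorph1 cE /=.
    by move: (\prod_(_ <- _) _) => P; rewrite rmorphM; ring.
case/andP: (pq) => p0 _.
rewrite !termE !(uinormZr hN) ?(ltW q0) // mulrCA.
by rewrite !ler_wpM2l ?(ltW q0) //; apply: uinorm_le_prod.
Qed.

Lemma uinorm_exp_diff_approx a : exists K : R, forall k,
  `|N (term exp_diff a) - N (term (pow_diff k) a)| <= K / k.+1%:R.
Proof.
(* Twice the constant of [expR_approx], which is applied at z and at - z. *)
pose C z : R := 4 * expR `|z| * z ^+ 2.
exists (\sum_i \sum_j C (a * (x i - y j)) * N (Z i j *: delta_mx i j)) => k.
have D := uinormD hN.
have h f g : N (term f a) - N (term g a) <= N (term (fun z => f z - g z) a).
  rewrite lerBlDr; apply: le_trans (D _ _); rewrite le_eqVlt; apply/orP; left.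
  apply/eqP; congr N; apply/matrixP => i j; rewrite !mxE rmorphB; ring.
have b f g : (forall z, `|f z - g z| <= C z / k.+1%:R) ->
    N (term f a) - N (term g a) <=
    (\sum_i \sum_j C (a * (x i - y j)) * N (Z i j *: delta_mx i j)) / k.+1%:R.
  move=> hfg; apply: le_trans (h _ _) _; apply: le_trans (uinorm_schur_le hN _ _) _.
  rewrite mulr_suml; apply: ler_sum => i _; rewrite mulr_suml; apply: ler_sum => j _.
  by rewrite mulrAC ler_wpM2r ?uinorm_ge0.
have bz z : `|exp_diff z - pow_diff k z| <= C z / k.+1%:R.
  have -> : exp_diff z - pow_diff k z =
      ((1 + - z / k.+1%:R) ^+ k.+1 - expR (- z)) -
      ((1 + z / k.+1%:R) ^+ k.+1 - expR z).
    by rewrite /exp_diff /pow_diff mulNr; ring.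
  apply: le_trans (ler_normB _ _) _.
  apply: le_trans (lerD (expR_approx _ _) (expR_approx _ _)) _.
  by rewrite normrN sqrrN /C le_eqVlt; apply/orP; left; apply/eqP; ring.
by rewrite ler_norml -lerN2 opprK opprB !b // => z; rewrite distrC.
Qed.

Lemma uinorm_exp_diff (p q : R) : 0 <= p <= q -> 0 < q ->
  q * N (term exp_diff p) <= p * N (term exp_diff q).
Proof.
move=> pq q0; have [Kp hp] := uinorm_exp_diff_approx p.
have [Kq hq] := uinorm_exp_diff_approx q; case/andP: (pq) => p0 _.
apply: (@ler_add_inv_nat _ _ _ (q * Kp + p * Kq)) => k.
have := uinorm_pow_diff k pq q0.
move: (hp k) (hq k); rewrite !ler_norml => /andP[_ h1] /andP[h2 _] h3.
move: (ler_wpM2l (ltW q0) h1) (ler_wpM2l p0 h2) h3.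
by move: (N _) (N _) (N _) (N _) k.+1%:R^-1 => a b c d e; lra.
Qed.

End Sinh.

(** * The inequality for diagonal matrices, zero eigenvalues included *)

(** For a = exp(2 x) and b = exp(2 y) this is exp(x + y) times 2 sinh((1 - 2 r)(x - y)). *)
Definition heinz_weight (R : realType) (r a b : R) : R :=
  a `^ (1 - r) * b `^ r - a `^ r * b `^ (1 - r).

Lemma uinorm_heinz_diag (R : realType) (n : nat) (N : 'M[R[i]]_n -> R)
    (a b : 'I_n -> R) (s t : R) (Y : 'M[R[i]]_n) :
  unitarily_invariant_norm N -> s < t -> 2 * t < 1 ->
  (s < 0 -> forall i, a i != 0 /\ b i != 0) ->
  (1 - 2 * s) * N (schur (fun i j => (heinz_weight t (a i) (b j))%:C) Y) <=
  (1 - 2 * t) * N (schur (fun i j => (heinz_weight s (a i) (b j))%:C) Y).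
Proof.
move=> hN st t12 ab0.
pose F r := schur (fun i j => (heinz_weight r (a i) (b j))%:C) Y.
rewrite -/(F s) -/(F t).
(* With these signs (1 + u) / 2 is the indicator of a nonzero entry, so [mask] is a pinching of the
   form treated in [uinorm_half_unimodular]. *)
pose u (c : 'I_n -> R) i : R[i] := if c i == 0 then -1 else 1.
have norm_u c i : `|u c i| = 1 by rewrite /u; case: ifP; rewrite ?normrN1 ?normr1.
pose mask i j : R[i] := (1 + u a i) / 2 * ((1 + u b j) / 2).
have maskE i j : mask i j = ((a i != 0) && (b j != 0))%:R.
  rewrite /mask /u; case: (a i == 0); case: (b j == 0) => /=; by field.
pose x i := ln (a i) / 2; pose y j := ln (b j) / 2.
pose Z := schur (fun i j => (expR (x i + y j))%:C) (schur mask Y).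
pose G r := schur (fun i j => (expR ((1 - 2 * r) * (x i - y j)) -
  expR (- ((1 - 2 * r) * (x i - y j))))%:C) Z.
have GE r : G r = schur mask (F r).
  apply/matrixP => i j; rewrite !mxE maskE.
  have [a0|a0] := eqVneq (a i) 0; first by rewrite /= !mul0r !mulr0.
  have [b0|b0] := eqVneq (b j) 0; first by rewrite /= !mul0r !mulr0.
  rewrite /= !mul1r mulrA -rmorphM; congr (_%:C * _).
  rewrite /heinz_weight /powR (negbTE a0) (negbTE b0) mulrBl -!expRD /x /y.
  by congr (expR _ - expR _); field.
(* Masking loses nothing at t: either s < 0 and no entry is zero, or 0 < t < 1 and both terms of the
   weight vanish at a zero entry. *)
have FtE : F t = G t.
  rewrite GE; apply/matrixP => i j; rewrite !mxE maskE /heinz_weight.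
  have [s0|s0] := ltP s 0.
    by case: (ab0 s0 i) (ab0 s0 j) => ai _ [_ bj]; rewrite ai bj mul1r.
  have t0 : t != 0 by rewrite gt_eqF //; lra.
  have t1 : 1 - t != 0 by rewrite gt_eqF //; lra.
  have [->|_] := eqVneq (a i) 0; first by rewrite !powR0 // !mul0r subrr rmorph0 !mul0r.
  have [->|_] := eqVneq (b j) 0; first by rewrite !powR0 // !mulr0 subrr rmorph0 !mul0r.
  by rewrite mul1r.
(* At s only an inequality is available: for s = 0 the weight is a - b by the convention on the
   zeroth power, and need not vanish on masked entries. *)
have Fs : N (G s) <= N (F s) by rewrite GE; exact: uinorm_half_unimodular.
rewrite FtE; apply: le_trans (ler_wpM2l _ Fs); last by lra.
by apply: uinorm_exp_diff => //; lra.
Qed.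

(** * Spectral decomposition and reduction to eigenbases *)

Lemma invmx_unitarymx (C : numClosedFieldType) (n : nat) (U : 'M[C]_n) :
  U \is unitarymx -> invmx U \is unitarymx.
Proof. by move=> Uu; rewrite invmx_unitary // trmxC_unitary. Qed.

Lemma mulmx_conjB (R : pzRingType) (n : nat) (P U V W X D1 D2 D3 D4 : 'M[R]_n) :
  P *m D1 *m U *m X *m (W *m D2 *m V) - P *m D3 *m U *m X *m (W *m D4 *m V) =
  P *m (D1 *m (U *m X *m W) *m D2 - D3 *m (U *m X *m W) *m D4) *m V.
Proof. by rewrite mulmxBr mulmxBl !mulmxA. Qed.

(** The witness is the eigenvector P^-1 e_i; this carries positive definiteness over to the
    eigenvalues. *)
Lemma unitary_diag_form (C : numClosedFieldType) (n : nat) (P : 'M[C]_n)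
    (d : 'rV[C]_n) (i : 'I_n) : P \is unitarymx ->
  exists2 u : 'cV[C]_n, u != 0 &
    (u ^t* *m (invmx P *m diag_mx d *m P) *m u)%sesqui 0 0 = d 0 i.
Proof.
move=> Pu; have Punit := unitarymx_unit Pu.
pose e : 'cV[C]_n := delta_mx i 0.
have Pe : P *m (invmx P *m e) = e by rewrite mulKVmx.
exists (invmx P *m e).
  apply/eqP => u0; move/matrixP/(_ i 0): Pe.
  by rewrite u0 mulmx0 !mxE !eqxx => /eqP; rewrite eq_sym oner_eq0.
rewrite -(mulmxA _ _ (invmx P *m e)) -(mulmxA _ P) Pe.
rewrite trmx_mul map_mxM !mulmxA invmx_unitary // trmxCK.
rewrite -(mulmxA _ P) (unitarymxP Pu) mulmx1.
rewrite -mulmxA mul_diag_mx mxE (bigD1 i) //= !mxE !eqxx conjC1 mul1r mulr1.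
rewrite big1 ?addr0 // => j /negPf ji.
by rewrite !mxE ji conjC0 mul0r.
Qed.

Lemma posdefmx_eig (R : realType) (n : nat) (A : 'M[R[i]]_n)
    (i : 'I_n) :
  posdefmx A -> complex.Re (spectral_diag A 0 i) != 0.
Proof.
case=> /hermitian_normalmx /orthomx_spectralP AE pos.
have [u u0] := unitary_diag_form (spectral_diag A) i (spectral_unitarymx A).
rewrite -AE => uE; have := pos u u0; rewrite uE ltcE /= => /andP[_ d0].
by rewrite gt_eqF.
Qed.

Section Heinz.
Variables (R : realType) (n : nat) (N : 'M[R[i]]_n -> R).
Hypothesis hN : unitarily_invariant_norm N.
Implicit Types A B X : 'M[R[i]]_n.

Let eig A i : R := complex.Re (spectral_diag A 0 i).

Lemma uinorm_unitary_conj (U V D1 D2 D3 D4 X : 'M[R[i]]_n) :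
  U \is unitarymx -> V \is unitarymx ->
  N (invmx U *m D1 *m U *m X *m (invmx V *m D2 *m V) -
     invmx U *m D3 *m U *m X *m (invmx V *m D4 *m V)) =
  N (D1 *m (U *m X *m invmx V) *m D2 - D3 *m (U *m X *m invmx V) *m D4).
Proof.
move=> Uu Vu.
have Uiu := invmx_unitarymx Uu.
by rewrite mulmx_conjB (uinormU hN _ Uiu Vu).
Qed.

(** All powers of A share one eigenbasis, as do those of B, so unitary invariance strips the outer
    unitaries. The matrix that remains under the multiplier is independent of r, which makes the
    exponents s and t comparable. *)
Lemma uinorm_heinzE A B X r :
  N (mxpow A (1 - r) *m X *m mxpow B r - mxpow A r *m X *m mxpow B (1 - r)) =
  N (schur (fun i j => (heinz_weight r (eig A i) (eig B j))%:C)
     (spectralmx A *m X *m invmx (spectralmx B))).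
Proof.
apply: etrans (uinorm_unitary_conj _ _ _ _ _ (spectral_unitarymx A)
  (spectral_unitarymx B)) _.
move: (spectralmx A *m X *m _) => Y.
rewrite !mul_diag_mx !mul_mx_diag; congr N; apply/matrixP => i j.
by rewrite !mxE /heinz_weight rmorphB !rmorphM mulrBl [_ * _ * Y i j]mulrAC
  [X in _ - X]mulrAC.
Qed.

Lemma uinorm_heinz_lt A B X s t : s < t -> 2 * t < 1 ->
  (s < 0 -> posdefmx A /\ posdefmx B) ->
  (1 - 2 * s) *
    N (mxpow A (1 - t) *m X *m mxpow B t - mxpow A t *m X *m mxpow B (1 - t)) <=
  (1 - 2 * t) *
    N (mxpow A (1 - s) *m X *m mxpow B s - mxpow A s *m X *m mxpow B (1 - s)).
Proof.
move=> st t12 pos.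
have eq_le (a b c d : R) : a = c -> b = d ->
    (1 - 2 * s) * c <= (1 - 2 * t) * d -> (1 - 2 * s) * a <= (1 - 2 * t) * b.
  by move=> -> ->.
apply: eq_le (uinorm_heinzE A B X t) (uinorm_heinzE A B X s) _.
apply: uinorm_heinz_diag => // s0 i.
by have [? ?] := pos s0; split; apply: posdefmx_eig.
Qed.

End Heinz.

Theorem theorem2p5 (R : realType) (n : nat) (s t : R)
    (A B X : 'M[R[i]]_n) (N : 'M[R[i]]_n -> R) :
  `|1 - 2 * t| < `|1 - 2 * s| ->
  (0 < 1 - 2 * t /\ 0 < 1 - 2 * s) \/ (1 - 2 * t < 0 /\ 1 - 2 * s < 0) ->
  psdmx A -> psdmx B ->
  (~~ (0 <= s <= 1) -> posdefmx A /\ posdefmx B) ->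
  unitarily_invariant_norm N ->
  N (mxpow A (1 - t) *m X *m mxpow B t - mxpow A t *m X *m mxpow B (1 - t))
  <= `|(1 - 2 * t) / (1 - 2 * s)| *
     N (mxpow A (1 - s) *m X *m mxpow B s - mxpow A s *m X *m mxpow B (1 - s)).
Proof.
move=> lt_ts sgn _ _ pos hN.
pose H p q := N (mxpow A p *m X *m mxpow B q - mxpow A q *m X *m mxpow B p).
(* Exchanging the exponents only changes the sign of the matrix; this gives the symmetry of s and t
   about 1/2. *)
have HC p q : H p q = H q p by rewrite /H -[LHS](uinormN hN) opprB.
have H_lt (s' t' : R) : s' < t' -> 2 * t' < 1 ->
    (s' < 0 -> posdefmx A /\ posdefmx B) ->
    (1 - 2 * s') * H (1 - t') t' <= (1 - 2 * t') * H (1 - s') s'.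
  exact: uinorm_heinz_lt.
change (H (1 - t) t <= `|(1 - 2 * t) / (1 - 2 * s)| * H (1 - s) s).
move: H HC H_lt => H HC H_lt.
have s0 : 0 < `|1 - 2 * s| by apply: le_lt_trans lt_ts.
rewrite normrM normfV mulrAC ler_pdivlMr // [H _ _ * _]mulrC.
case: sgn => -[t_sgn s_sgn].
  move: lt_ts; rewrite !gtr0_norm // => lt_ts.
  apply: H_lt; [lra | lra | move=> s_neg; apply: pos].
  by rewrite leNgt s_neg.
move: lt_ts; rewrite !ltr0_norm // => lt_ts.
(* Now 1/2 < t < s, so the reflected pair satisfies 1 - s < 1 - t < 1/2, and 1 - s < 0 means s > 1,
   where definiteness is assumed. *)
have := H_lt (1 - s) (1 - t); rewrite !subKr ![H (1 - _) _]HC.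
rewrite (_ : 1 - 2 * (1 - t) = - (1 - 2 * t)); last by ring.
rewrite (_ : 1 - 2 * (1 - s) = - (1 - 2 * s)); last by ring.
apply; [lra | lra | move=> s_neg; apply: pos].
by apply/negP => /andP[_]; lra.
Qed.
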